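(* Let $f:\mathbb{R}^n\to\mathbb{R}^n$ and $g:\mathbb{R}^n\to\mathbb{R}^{n\times m}$ be of class $C^1$ with $f(0)=0$. Let $\lambda:\mathbb{R}^n\to\mathbb{C}$ of class $C^0$ and $v:\mathbb{R}^n\to\mathbb{C}^n\setminus\{0_{n\times 1}\}$ of class $C^1$ be, respectively, a nonlinear right eigenvalue and its associated nonlinear right eigenvector of $\dot x=f(x)$ on a subset $D_x\subset\mathbb{R}^n$. If $k:\mathbb{R}^n\to\mathbb{R}^m$ of class $C^1$ with $k(0)=0$ satisfies $$[v(x),\,g(x)k(x)]=0$$ for all $x\in D_x$, then $\lambda(x)$ and $v(x)$ are a nonlinear right eigenvalue and an associated nonlinear right eigenvector of the closed-loop system $\dot x=f(x)+g(x)k(x)$ on $D_x$.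
   Context: For differentiable vector fields $v,s:\mathbb{R}^n\to\mathbb{C}^n$, the Lie bracket is $[v(x),s(x)]:=\frac{\partial s(x)}{\partial x}v(x)-\frac{\partial v(x)}{\partial x}s(x)$. Definition (nonlinear right eigenvalue/eigenvector). Let $s:\mathbb{R}^n\to\mathbb{R}^n$ be of class $C^1$ with $s(0)=0$ and let $D\subseteq\mathbb{R}^n$. A class $C^0$ function $\lambda$ with values in $\mathbb{C}$ and a class $C^1$ function $v$ with values in $\mathbb{C}^n$ that is nonzero on $D$ are called, respectively, a nonlinear right eigenvalue and an associated nonlinear right eigenvector of $\dot x=s(x)$ on $D$ if $[v(x),s(x)]=\lambda(x)v(x)$ for all $x\in D$. *)

(* Defs.v *)
From HB Require Import structures.
From mathcomp Require Import all_boot all_order all_algebra.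
From mathcomp Require Import all_classical all_reals all_analysis.
From mathcomp Require Export complex.
Import Order.TTheory GRing.Theory Num.Theory.
Import numFieldNormedType.Exports.

Set Implicit Arguments.
Unset Strict Implicit.
Unset Printing Implicit Defensive.

Local Open Scope classical_set_scope.
Local Open Scope ring_scope.

(* R^n is 'cV[R]_n and C^n is 'cV[R[i]]_n.  The library gives 'cV[R[i]]_n no
   normed structure over R, so the differential calculus of C^n-valued maps of
   a real variable goes through their real and imaginary parts. *)

Definition reV (R : realType) (n p : nat)
    (v : 'cV[R]_n -> 'cV[R[i]]_p) (x : 'cV[R]_n) : 'cV[R]_p :=
  map_mx (@complex.Re R) (v x).

Definition imV (R : realType) (n p : nat)
    (v : 'cV[R]_n -> 'cV[R[i]]_p) (x : 'cV[R]_n) : 'cV[R]_p :=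
  map_mx (@complex.Im R) (v x).

Definition complexify (R : realType) (n p : nat)
    (s : 'cV[R]_n -> 'cV[R]_p) (x : 'cV[R]_n) : 'cV[R[i]]_p :=
  map_mx (fun r : R => Complex r 0) (s x).

(* The domain is finite-dimensional, so continuity of x |-> 'D_u f x for every
   direction u is the same as continuity of the derivative. *)
Definition classC1 (R : realType) (n : nat) (W : normedModType R)
    (f : 'cV[R]_n -> W) : Prop :=
  (forall x : 'cV[R]_n, differentiable f x) /\
  (forall u : 'cV[R]_n, continuous (fun x : 'cV[R]_n => 'D_u f x)).

Definition classC1_complex (R : realType) (n p : nat)
    (v : 'cV[R]_n -> 'cV[R[i]]_p) : Prop :=
  classC1 (reV v) /\ classC1 (imV v).

(* R[i]^o carries the topology of the complex modulus. *)
Definition classC0_complex (R : realType) (n : nat)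
    (lambda : 'cV[R]_n -> R[i]) : Prop :=
  continuous (lambda : 'cV[R]_n -> R[i]^o).

(* Column convention: entry (i, j) is the partial derivative of the i-th
   component along the j-th coordinate, i.e. the transpose of the library's
   [jacobian], which acts on row vectors. *)
Definition jacobian_complex (R : realType) (n p : nat)
    (v : 'cV[R]_n -> 'cV[R[i]]_p) (x : 'cV[R]_n) : 'M[R[i]]_(p, n) :=
  \matrix_(i < p, j < n)
    Complex ('D_(delta_mx j ord0) (reV v) x i ord0)
            ('D_(delta_mx j ord0) (imV v) x i ord0).

Definition lie_bracket (R : realType) (n : nat)
    (v s : 'cV[R]_n -> 'cV[R[i]]_n) (x : 'cV[R]_n) : 'cV[R[i]]_n :=
  jacobian_complex s x *m v x - jacobian_complex v x *m s x.

(* The standing assumptions on the system xdot = s(x) are part of the notion. *)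
Definition nonlinear_right_eigenpair (R : realType) (n : nat)
    (s : 'cV[R]_n -> 'cV[R]_n) (D : set 'cV[R]_n)
    (lambda : 'cV[R]_n -> R[i]) (v : 'cV[R]_n -> 'cV[R[i]]_n) : Prop :=
  (classC1 s /\ s 0 = 0) /\
  classC0_complex lambda /\
  classC1_complex v /\
  (forall x, D x -> v x <> 0) /\
  (forall x, D x -> lie_bracket v (complexify s) x = lambda x *: v x).

(* Main.v *)
Require Import Defs.
From HB Require Import structures.
From mathcomp Require Import all_boot all_order all_algebra.
From mathcomp Require Import all_classical all_reals all_analysis.
Import Order.TTheory GRing.Theory Num.Theory.
Import numFieldNormedType.Exports.

Local Open Scope classical_set_scope.
Local Open Scope ring_scope.

(** For a fixed [v], the bracket is additive in its second argument, because both the Jacobian of a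
    vector field and its value at a point are additive in the field. Hence [v, f + gk] = [v, f] +
    [v, gk] = lambda v + 0 on [Dx]; this is [lie_bracket_complexifyD]. The eigenpair notion also
    asks that the closed-loop field be of class C^1 and vanish at 0. The former comes from closure
    of C^1 under sums and matrix products ([classC1D], [classC1_mulmx]), the latter from f(0) = 0
    and k(0) = 0. *)

Lemma classC1D (R : realType) (n : nat) (W : normedModType R)
    (a b : 'cV[R]_n -> W) :
  classC1 a -> classC1 b -> classC1 (fun x => a x + b x).
Proof.
move=> [da ca] [db cb]; split=> [x|u]; first exact: differentiableD.
have -> : (fun x => 'D_u (fun y => a y + b y) x) =
          (fun x => 'D_u a x + 'D_u b x).
  by apply/funext => x; apply: deriveD; apply: diff_derivable.
by move=> x; exact: (cvgD (ca u x) (cb u x)).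
Qed.

Lemma classC1M (R : realType) (n : nat) (a b : 'cV[R]_n -> R) :
  classC1 a -> classC1 b -> classC1 (fun x => a x * b x).
Proof.
move=> [da ca] [db cb]; split=> [x|u]; first exact: differentiableM.
have -> : (fun x => 'D_u (fun y => a y * b y) x) =
          (fun x => a x * 'D_u b x + b x * 'D_u a x).
  by apply/funext => x; apply: deriveM; apply: diff_derivable.
(* The Leibniz formula contains [a] and [b] themselves, so their continuity is needed besides that
   of their derivatives. *)
move=> x; have cax := differentiable_continuous (da x).
have cbx := differentiable_continuous (db x).
exact: (cvgD (cvgM cax (cb u x)) (cvgM cbx (ca u x))).
Qed.

Lemma classC1_cst (R : realType) (n : nat) (W : normedModType R) (w : W) :
  classC1 (fun _ : 'cV[R]_n => w).
Proof.
split=> [x|u]; first exact: differentiable_cst.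
have -> : (fun x => 'D_u (fun _ : 'cV[R]_n => w) x) = cst 0.
  by apply/funext => x; exact: derive_cst.
exact: cst_continuous.
Qed.

Lemma classC1_sum (R : realType) (n : nat) (W : normedModType R)
    (I : Type) (r : seq I) (F : I -> 'cV[R]_n -> W) :
  (forall i, classC1 (F i)) -> classC1 (fun x => \sum_(i <- r) F i x).
Proof.
move=> hF; elim: r => [|i r IHr].
  by under eq_fun do rewrite big_nil; exact: classC1_cst.
by under eq_fun do rewrite big_cons; exact: classC1D.
Qed.

(** Serves [classC1_mx], where [w] is an elementary matrix and [a] an entry. *)
Lemma classC1Zl (R : realType) (n : nat) (W : normedModType R)
    (a : 'cV[R]_n -> R) (w : W) :
  classC1 a -> classC1 (fun x => a x *: w).
Proof.
move=> [da ca]; split=> [x|u]; first exact: differentiableZl.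
have -> : (fun x => 'D_u (fun y => a y *: w) x) = (fun x => 'D_u a x *: w).
  apply/funext => x; rewrite !deriveE//; last exact: differentiableZl.
  by rewrite diffZl.
by move=> x; exact: (cvgZr_tmp (ca u x)).
Qed.

(** Reading off an entry is linear and continuous, so it commutes with directional derivatives and
    preserves their continuity. *)
Lemma classC1_coord (R : realType) (n p q : nat)
    (F : 'cV[R]_n -> 'M[R]_(p, q)) (i : 'I_p) (j : 'I_q) :
  classC1 F -> classC1 (fun x => F x i j).
Proof.
move=> [dF cF]; split=> [x|u].
  exact: (differentiable_comp (dF x) (differentiable_coord (F x) i j)).
have -> : (fun x => 'D_u (fun y => F y i j) x) = (fun x => 'D_u F x i j).
  by apply/funext => x; rewrite derive_mx ?mxE//; exact: diff_derivable.
by move=> x; exact: (continuous_comp (cF u x) (@coord_continuous _ _ _ i j _)).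
Qed.

(** A matrix is the finite sum of its entries times the constant elementary matrices, so regularity
    passes from the entries to the whole. With [classC1_coord], this reduces matrix products to
    scalar sums and products. *)
Lemma classC1_mx (R : realType) (n p q : nat)
    (F : 'cV[R]_n -> 'M[R]_(p, q)) :
  (forall i j, classC1 (fun x => F x i j)) -> classC1 F.
Proof.
move=> hF; under [F]eq_fun do rewrite [F _]matrix_sum_delta.
do 2![apply: classC1_sum => ?]; exact: classC1Zl.
Qed.

Lemma classC1_mulmx (R : realType) (n p q r : nat)
    (A : 'cV[R]_n -> 'M[R]_(p, q)) (B : 'cV[R]_n -> 'M[R]_(q, r)) :
  classC1 A -> classC1 B -> classC1 (fun x => A x *m B x).
Proof.
move=> hA hB; apply: classC1_mx => i j; under eq_fun do rewrite mxE.
by apply: classC1_sum => l; apply: classC1M; exact: classC1_coord.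
Qed.

Lemma reV_complexify (R : realType) (n p : nat) (s : 'cV[R]_n -> 'cV[R]_p) :
  reV (complexify s) = s.
Proof. by apply/funext => x; apply/matrixP => i j; rewrite !mxE. Qed.

Lemma imV_complexify (R : realType) (n p : nat) (s : 'cV[R]_n -> 'cV[R]_p) :
  imV (complexify s) = cst 0.
Proof. by apply/funext => x; apply/matrixP => i j; rewrite !mxE. Qed.

Lemma complexifyD (R : realType) (n p : nat) (s t : 'cV[R]_n -> 'cV[R]_p) x :
  complexify (fun y => s y + t y) x = complexify s x + complexify t x.
Proof.
by apply/matrixP => i j; rewrite !mxE; apply/eqP; rewrite eq_complex /= addr0 !eqxx.
Qed.

(** The real parts add by linearity of the derivative, for which differentiability is assumed; the
    imaginary part of a complexified real field is constantly 0, so its derivatives vanish. *)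
Lemma jacobian_complexifyD (R : realType) (n p : nat)
    (s t : 'cV[R]_n -> 'cV[R]_p) x :
  differentiable s x -> differentiable t x ->
  jacobian_complex (complexify (fun y => s y + t y)) x =
  jacobian_complex (complexify s) x + jacobian_complex (complexify t) x.
Proof.
move=> ds dt; apply/matrixP => i j; rewrite !mxE !reV_complexify !imV_complexify.
have -> : 'D_(delta_mx j ord0) (fun y => s y + t y) x =
          'D_(delta_mx j ord0) s x + 'D_(delta_mx j ord0) t x.
  by apply: deriveD; exact: diff_derivable.
by apply/eqP; rewrite eq_complex /= !derive_cst !mxE addr0 !eqxx.
Qed.

(** At a fixed [x] the vector [v x] and the Jacobian of [v] are constant matrices; distributivity of
    the matrix product then splits both terms of the bracket. *)
Lemma lie_bracket_complexifyD (R : realType) (n : nat)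
    (v : 'cV[R]_n -> 'cV[R[i]]_n) (s t : 'cV[R]_n -> 'cV[R]_n) x :
  differentiable s x -> differentiable t x ->
  lie_bracket v (complexify (fun y => s y + t y)) x =
  lie_bracket v (complexify s) x + lie_bracket v (complexify t) x.
Proof.
move=> ds dt; rewrite /lie_bracket jacobian_complexifyD// complexifyD.
by rewrite mulmxDl mulmxDr opprD addrACA.
Qed.

Theorem theorem2 (R : realType) (n m : nat)
    (f : 'cV[R]_n -> 'cV[R]_n) (g : 'cV[R]_n -> 'M[R]_(n, m))
    (hf : classC1 f) (hg : classC1 g) (hf0 : f 0 = 0)
    (lambda : 'cV[R]_n -> R[i]) (v : 'cV[R]_n -> 'cV[R[i]]_n)
    (hlambda : classC0_complex lambda)
    (hv : classC1_complex v) (hv0 : forall x, v x <> 0)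
    (Dx : set 'cV[R]_n)
    (heig : nonlinear_right_eigenpair f Dx lambda v)
    (k : 'cV[R]_n -> 'cV[R]_m) (hk : classC1 k) (hk0 : k 0 = 0)
    (hbracket : forall x, Dx x ->
       lie_bracket v (complexify (fun y => g y *m k y)) x = 0) :
  nonlinear_right_eigenpair (fun x => f x + g x *m k x) Dx lambda v.
Proof.
have hgk : classC1 (fun x => g x *m k x) by exact: classC1_mulmx.
case: heig => _ [_ [_ [vN0 hlie]]]; split.
  by split; [exact: classC1D|rewrite hf0 hk0 mulmx0 addr0].
split=> //; split=> //; split=> // x Dxx.
(* The bracket splits into the open-loop part, equal to lambda v, and the feedback part, which
   vanishes on [Dx]. *)
rewrite lie_bracket_complexifyD; [|exact: hf.1|exact: hgk.1].
by rewrite hlie// hbracket// addr0.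
Qed.
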